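(* Let $d\ge1$ and let $H$ be a hypergraph of $d$-intervals. Then (1) $\tau(H)\le(d^2-d+1)\,\nu(H)$, and (2) $\tau(H)\le d\,\nu^*(H)$.
   Context: A $d$-interval is a union of at most $d$ pairwise disjoint closed intervals of the real line $\mathbb{R}$. A hypergraph of $d$-intervals is a finite family $H$ of $d$-intervals, regarded as a hypergraph whose vertices are the points of $\mathbb{R}$ and whose edges are the members of $H$. A matching is a set of pairwise disjoint edges and $\nu(H)$ is the maximum size of a matching. A cover is a set of points meeting every edge and $\tau(H)$ is the minimum size of a cover. A fractional matching is $f:H\to\mathbb{R}_{\ge0}$ with $\sum_{h\ni v}f(h)\le1$ for every point $v$; $\nu^*(H)$ is the maximum of $\sum_h f(h)$ over fractional matchings. *)

(* Defs.v *)
(* The real line is modelled by an arbitrary real field R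
   (R : realFieldType); the statement is purely order-theoretic. *)
From HB Require Import structures.
From mathcomp Require Import all_boot all_order all_algebra.
From Stdlib Require Import ClassicalEpsilon.
Set Implicit Arguments. Unset Strict Implicit. Unset Printing Implicit Defensive.
Import Order.TTheory GRing.Theory Num.Theory.
Local Open Scope ring_scope.

Definition in_interval (R : realFieldType) (I : R * R) (x : R) : bool :=
  (I.1 <= x) && (x <= I.2).

Definition in_dint (R : realFieldType) (h : seq (R * R)) (x : R) : bool :=
  has (fun I => in_interval I x) h.

Definition is_dinterval (R : realFieldType) (d : nat) (h : seq (R * R)) : Prop :=
  [/\ (0 < size h)%N, (size h <= d)%N,
      (forall I, I \in h -> I.1 <= I.2) &
      (forall i j, (i < size h)%N -> (j < size h)%N -> i <> j ->
         forall x, ~ (in_interval (nth (0,0) h i) x && in_interval (nth (0,0) h j) x))].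

(* A hypergraph of d-intervals: a finite family (list, repetitions allowed). *)
Definition dhypergraph (R : realFieldType) (d : nat) (H : seq (seq (R * R))) : Prop :=
  forall h, h \in H -> is_dinterval d h.

Definition edge (R : realFieldType) (H : seq (seq (R * R))) (i : nat) : seq (R * R) :=
  nth [::] H i.

Definition disjoint_edges (R : realFieldType) (h1 h2 : seq (R * R)) : Prop :=
  forall x, ~ (in_dint h1 x && in_dint h2 x).

Definition is_matching (R : realFieldType) (H : seq (seq (R * R)))
    (M : {set 'I_(size H)}) : Prop :=
  forall i j, i \in M -> j \in M -> i != j -> disjoint_edges (edge H i) (edge H j).

Definition pbool (P : Prop) : bool :=
  if excluded_middle_informative P then true else false.

Definition nu (R : realFieldType) (H : seq (seq (R * R))) : nat :=
  \max_(M : {set 'I_(size H)} | pbool (@is_matching R H M)) #|M|.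

(* A cover: a finite set of points meeting every edge. tau(H) <= m is
   expressed as the existence of a cover with at most m points. *)
Definition is_cover (R : realFieldType) (H : seq (seq (R * R))) (C : seq R) : Prop :=
  forall i, (i < size H)%N -> exists2 x, x \in C & in_dint (edge H i) x.

Definition is_frac_matching (R : realFieldType) (H : seq (seq (R * R)))
    (f : 'I_(size H) -> R) : Prop :=
  (forall i, 0 <= f i) /\
  (forall v : R, \sum_(i < size H | in_dint (edge H i) v) f i <= 1).

Arguments is_matching {R} H M.
Arguments is_frac_matching {R} H f.

(* Main.v *)
Require Import Defs.
From HB Require Import structures.
From mathcomp Require Import all_boot all_order all_algebra.
From mathcomp Require Import zify lra.
From Stdlib Require Import ClassicalEpsilon.
Import Order.TTheory GRing.Theory Num.Theory.
Local Open Scope ring_scope.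
Set Implicit Arguments. Unset Strict Implicit. Unset Printing Implicit Defensive.

(** Let [n = tau(H)]. A point [x] of the (discretised) simplex on [n] vertices cuts
    the line into [n] cells; as [n - 1] points cover nothing, some edge [h x] avoids all
    the cuts, and [L x] is the set of the at most [d] cells that it meets. Scarf's lemma
    yields mutually close points [x] and weights [w x >= 0] with
    [sum_(x : i \in L x) w x = 1] for every cell [i]. Closeness makes the cells of the
    different [x] interchangeable, so [w] is a fractional matching of the edges [h x],
    and counting incidences gives [n = sum_x w x * #|L x| <= d * sum_x w x], which is (2).
    For (1), Füredi's bound [nu* <= (d - 1 + 1/d) nu] is applied to the family [L].

    Scarf's lemma is proved by a parity count: the feasible bases of a nondegenerate
    system form a cocycle mod 2, and the dominating sets together with the set of
    slacks form a cycle mod 2, so the two families have an even intersection. *)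

(** * Scarf's lemma *)

Lemma pboolP (P : Prop) : reflect P (pbool P).
Proof. by rewrite /pbool; case: excluded_middle_informative => H; constructor. Qed.

Lemma odd_sum (I : Type) (r : seq I) (P : pred I) (F : I -> nat) :
  odd (\sum_(i <- r | P i) F i) = odd (\sum_(i <- r | P i) odd (F i)).
Proof.
elim/big_ind2: _ => // [x1 x2 y1 y2 H1 H2|i _]; last by rewrite oddb.
by rewrite !oddD H1 H2.
Qed.

(** * Intersection mod 2 of a cocycle with a cycle *)

Section Parity.
Variables (X : finType) (n : nat) (O C : pred {set X}).
Hypothesis cocycleC : forall K : {set X}, #|K| = n.+1 ->
  ~~ odd #|[set k in K | C (K :\ k)]|.
Hypothesis cycleO : forall S : {set X}, #|S|.+1 = n ->
  ~~ odd #|[set k | (k \notin S) && O (k |: S)]|.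

(* A cocycle of the full simplex is the coboundary of its cone from [p]. *)
Lemma cocycle_is_coboundary (p : X) (J : {set X}) : #|J| = n ->
  C J = odd #|[set j in J | (p \notin J :\ j) && C (p |: J :\ j)]|.
Proof.
move=> cJ; have [pJ|pJ] := boolP (p \in J).
  have -> : [set j in J | (p \notin J :\ j) && C (p |: J :\ j)]
          = if C J then [set p] else set0.
    apply/setP=> j; rewrite !inE pJ andbT negbK.
    have [<-|npj] := eqVneq p j.
      by rewrite pJ setD1K //; case: (C J); rewrite !inE ?eqxx.
    by rewrite andbF; case: (C J); rewrite !inE 1?eq_sym ?(negbTE npj).
  by case: (C J); rewrite ?cards1 ?cards0.
have := cocycleC (K := p |: J); rewrite cardsU1 pJ cJ => /(_ erefl).
rewrite (cardsD1 p) !inE eqxx /= setU1K //.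
have -> : [set k in p |: J | C ((p |: J) :\ k)] :\ p
   = [set j in J | (p \notin J :\ j) && C (p |: J :\ j)].
  apply/setP=> j; rewrite !inE (negbTE pJ) andbF /=.
  have [->|njp] /= := eqVneq j p; first by rewrite (negbTE pJ).
  congr (_ && C _); apply/setP=> y; rewrite !inE.
  by have [->|] //= := eqVneq y p; rewrite eq_sym njp.
by rewrite oddD oddb; case: (C J); case: (odd _).
Qed.

(** Write [C] as the coboundary of [D], its cone from a fixed [p]. Grouping the resulting double sum
    by faces [S] of size [n - 1], each [S] contributes [D S] times the number of its extensions in
    [O], which is even. *)
Lemma cocycle_cycle_parity : (0 < n)%N ->
  ~~ odd #|[set J : {set X} | [&& #|J| == n, O J & C J]]|.
Proof.
move=> n0; case: (pickP (@predT X)) => [p _|X0]; last first.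
  rewrite (_ : [set J | _] = set0) ?cards0 //; apply/setP=> J; rewrite !inE.
  have -> : #|J| = 0%N by apply: eq_card0 => x; have := X0 x.
  by case: n n0.
pose D (S : {set X}) := (p \notin S) && C (p |: S).
rewrite -sum1_card.
have -> : (\sum_(J in [set J : {set X} | [&& #|J| == n, O J & C J]]) 1
   = \sum_(J : {set X} | (#|J| == n) && O J) C J)%N.
  rewrite [RHS](eq_bigr (fun J => if C J then 1 else 0)%N); last first.
    by move=> J _; case: (C J).
  rewrite -big_mkcondr /=; apply: eq_bigl => J.
  by rewrite inE andbA.
have -> : odd (\sum_(J : {set X} | (#|J| == n) && O J) C J)
  = odd (\sum_(J : {set X} | (#|J| == n) && O J) \sum_(j in J) D (J :\ j)).
  rewrite odd_sum [RHS]odd_sum; congr odd; apply: eq_bigr => J /andP[/eqP cJ _].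
  rewrite oddb (cocycle_is_coboundary p cJ) -sum1_card; congr (nat_of_bool (odd _)).
  rewrite [RHS](eq_bigr (fun j => if D (J :\ j) then 1 else 0)%N); last first.
    by move=> j _; case: (D _).
  by rewrite -big_mkcondr /=; apply: eq_bigl => j; rewrite inE.
rewrite pair_big_dep /=.
rewrite (reindex_onto (fun u : {set X} * X => (u.2 |: u.1, u.2))
                      (fun u : {set X} * X => (u.1 :\ u.2, u.2))) /=; last first.
  by move=> [J j] /= /andP[_ jJ]; rewrite setD1K.
rewrite (eq_bigl (fun u : {set X} * X => (#|u.1|.+1 == n) &&
   ((u.2 \notin u.1) && O (u.2 |: u.1)))); last first.
  move=> [S k] /=; rewrite setU11 andbT cardsU1.
  have -> : (((k |: S) :\ k, k) == (S, k)) = (k \notin S).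
    apply/eqP/idP => [[<-]|kS]; first by rewrite !inE eqxx.
    by rewrite setU1K.
  by case: (k \notin S) => /=; rewrite ?andbF ?andbT //.
rewrite -(pair_big_dep (fun S : {set X} => #|S|.+1 == n)
  (fun S k => (k \notin S) && O (k |: S)) (fun S k => nat_of_bool (D ((k |: S) :\ k)))).
rewrite odd_sum big1 // => S /eqP cS; apply/eqP; rewrite eqb0.
rewrite (eq_bigr (fun _ => nat_of_bool (D S))); last first.
  by move=> k /andP[kS _]; rewrite setU1K.
rewrite sum_nat_const oddM negb_and; apply/orP; left.
by have := cycleO cS; rewrite cardsE.
Qed.
End Parity.

(** * Linear orders and dominating sets *)

Section Ordinal.
Variables (X : finType) (n : nat) (c : 'I_n -> X -> nat) (sl : 'I_n -> X).
Hypothesis injc : forall i, injective (c i).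
Hypothesis injsl : injective sl.
Hypothesis sl_min : forall i x, (c i (sl i) <= c i x)%N.
Hypothesis sl_big : forall i j x, j != i -> x \notin codom sl -> (c i x < c i (sl j))%N.

Definition dominating (J : {set X}) : bool :=
  [forall y, exists i, forall x in J, (c i y <= c i x)%N].

Definition slacks : {set X} := [set sl i | i : 'I_n].

Lemma dominatingP (J : {set X}) :
  reflect (forall y, exists i, forall x, x \in J -> (c i y <= c i x)%N) (dominating J).
Proof.
apply: (iffP forallP) => H y; first by have /existsP[i /forall_inP ?] := H y; exists i.
by apply/existsP; have [i ?] := H y; exists i; apply/forall_inP.
Qed.

Lemma mem_slacks x : (x \in slacks) = (x \in codom sl).
Proof. by apply/imsetP/codomP => [[i _ ->]|[i ->]]; exists i. Qed.

(** Let [sl m] be the slack missing from [S]. Non-slacks can be dominated only in order [m], since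
    [S] contains the minimum [sl i] of every other order. Hence a non-slack completion is the
    maximum of the non-slacks in order [m]; the other completion is [sl m], giving [slacks]. *)
Lemma dominating_over_slack_face (S : {set X}) g :
  #|S|.+1 = n -> S \subset slacks -> g \notin codom sl ->
  #|[set k | (k \notin S) && (dominating (k |: S) || (k |: S == slacks))]| = 2.
Proof.
move=> cS Ssub gN.
have cslacks : #|slacks| = n by rewrite card_imset // card_ord.
have /subsetPn[x xs xS] : ~~ (slacks \subset S).
  by apply/negP => /subset_leq_card; rewrite cslacks -cS ltnn.
have [m xm] : exists m, x = sl m by move: xs => /imsetP[m _ ->]; exists m.
subst x.
have eS : sl m |: S = slacks.
  apply/eqP; rewrite eqEcard subUset sub1set xs Ssub /= cardsU1 xS cslacks -cS.
  by rewrite add1n.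
have slS i : i != m -> sl i \in S.
  move=> im; have : sl i \in sl m |: S by rewrite eS mem_slacks codom_f.
  by rewrite !inE (inj_eq injsl) (negbTE im).
case: (@arg_maxnP X g (fun x => x \notin codom sl) (c m) gN) => k kN kmax.
have kslm : k != sl m by apply: contraNneq kN => ->; rewrite codom_f.
suff -> : [set k | (k \notin S) && (dominating (k |: S) || (k |: S == slacks))]
   = [set k; sl m] by rewrite cards2 kslm.
apply/setP => y; rewrite !inE; apply/idP/idP; last first.
  case/orP => /eqP ->; last by rewrite xS eS eqxx orbT.
  have -> /= : k \notin S.
    by apply: contra kN => kS; rewrite -mem_slacks (subsetP Ssub).
  apply/orP; left; apply/dominatingP => z.
  have [/codomP[i ->]|zN] := boolP (z \in codom sl); first by exists i.
  exists m => t; rewrite !inE => /orP[/eqP ->|tS]; first exact: kmax.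
  have /imsetP[j _ tj] := subsetP Ssub _ tS; subst t.
  by apply/ltnW/sl_big => //; apply: contraNneq xS => <-.
case/andP=> yS; have [/codomP[i yi]|yN] := boolP (y \in codom sl).
  move=> _; subst y; have [->|im] := eqVneq i m; first by rewrite eqxx orbT.
  by rewrite slS in yS.
case/orP => [/dominatingP/(_ k)[i Hi]|/eqP E]; last first.
  by move: yN; rewrite -mem_slacks -E setU11.
have im : i = m.
  apply/eqP/negPn/negP=> im; have := Hi (sl i); rewrite !inE slS ?orbT // => /(_ isT) le.
  have : k = sl i by apply: (@injc i); apply/eqP; rewrite eqn_leq le sl_min.
  by move=> ki; move: kN; rewrite ki codom_f.
subst i; have := Hi y; rewrite setU11 => /(_ isT) le.
by apply/orP; left; apply/eqP/(@injc m)/eqP; rewrite eqn_leq le andbT; apply: kmax.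
Qed.

(** Scarf's pivot. The minima of [S] in the [n] orders exhaust its [n - 1] elements, so exactly one
    value occurs twice, in orders [i0] and [i1]. A completing element must own one of these orders,
    and the order it owns determines it. *)
Lemma dominating_over_face (S : {set X}) g k :
  #|S|.+1 = n -> g \in S -> g \notin codom sl -> k \notin S -> dominating (k |: S) ->
  #|[set k | (k \notin S) && dominating (k |: S)]| = 2.
Proof.
move=> cS gS gN kS domk.
pose mn i := [arg min_(x < g in S) c i x].
have mnS i : mn i \in S by rewrite /mn; case: arg_minnP.
have mnmin i x : x \in S -> (c i (mn i) <= c i x)%N.
  by rewrite /mn; case: arg_minnP => // y yS H; apply: H.
have mnE i x : x \in S -> (c i x <= c i (mn i))%N -> x = mn i.
  by move=> xS le; apply: (@injc i); apply/eqP; rewrite eqn_leq le mnmin.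
have lt_neq i x y : x != y -> (c i x <= c i y)%N -> (c i x < c i y)%N.
  by move=> xy le; rewrite ltn_neqAle le andbT (inj_eq (@injc i)).
(* In a dominating set each element is the minimum of its own order. *)
have struct y : y \notin S -> dominating (y |: S) -> exists i0,
    [/\ forall x, x \in S -> (c i0 y < c i0 x)%N,
        forall i, i != i0 -> (c i (mn i) < c i y)%N,
        {in [pred i | i != i0] &, injective mn} &
        forall x, x \in S -> exists2 i, i != i0 & mn i = x].
  move=> yS dom.
  have Hr x : exists i, [forall z in y |: S, (c i x <= c i z)%N].
    by move/dominatingP: dom => /(_ x) [i Hi]; exists i; apply/forall_inP.
  pose r x := xchoose (Hr x).
  have rP x z : z \in y |: S -> (c (r x) x <= c (r x) z)%N.
    by move=> zJ; have /forall_inP := xchooseP (Hr x); apply.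
  have rinj : {in y |: S &, injective r}.
    move=> u v uJ vJ ruv; apply: (@injc (r u)); apply/eqP.
    by rewrite eqn_leq rP //= ruv rP.
  have rsurj i : exists2 x, x \in y |: S & r x = i.
    have : i \in r @: (y |: S).
      have -> : r @: (y |: S) = setT; last by rewrite inE.
      apply/eqP; rewrite eqEcard subsetT cardsT card_ord card_in_imset //.
      by rewrite cardsU1 yS add1n cS leqnn.
    by case/imsetP => x xJ ->; exists x.
  have rS x : x \in S -> x = mn (r x).
    by move=> xS; apply: mnE => //; apply: rP; rewrite inE mnS orbT.
  have rneq x : x \in S -> r x != r y.
    move=> xS; apply/eqP => E; move: yS.
    by rewrite -(rinj x y _ _ E) ?xS ?setU11 // inE xS orbT.
  have key i : i != r y -> exists2 x, x \in S & r x = i.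
    move=> ii; have [x] := rsurj i; rewrite !inE => /orP[/eqP ->|xS] E; last by exists x.
    by rewrite E eqxx in ii.
  exists (r y); split.
  - move=> x xS; apply: lt_neq; last by apply: rP; rewrite inE xS orbT.
    by apply: contraNneq yS => ->.
  - move=> i /key [x xS <-]; rewrite -rS //; apply: lt_neq; last by apply: rP; rewrite setU11.
    by apply: contraNneq yS => <-.
  - move=> i j; rewrite !inE => /key[x xS <-] /key[z zS <-].
    by rewrite -!rS // => ->.
  - by move=> x xS; exists (r x); [exact: rneq | exact/esym/rS].
have [i0 [k1 k2 k3 k4]] := struct _ kS domk.
have [i1 i10 mni1] := k4 _ (mnS i0).
(* Elements of [Y i] exceed the minimum of [S] in every order except [i], so a completion of [S] can
   dominate them only in order [i]. *)
pose Y i := [pred y | [forall j, (j != i) ==> (c j (mn j) < c j y)%N]].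
have YP i y : reflect (forall j, j != i -> (c j (mn j) < c j y)%N) (Y i y).
  by apply: (iffP forallP) => H j; [have /implyP := H j | apply/implyP; apply: H].
have max_of y j0 z : dominating (y |: S) -> Y j0 z -> (c j0 z <= c j0 y)%N.
  move=> /dominatingP dom /YP Yz; have [i Hi] := dom z.
  have [<-|ij] := eqVneq i j0; first by apply: Hi; rewrite setU11.
  by have := Yz _ ij; rewrite ltnNge Hi // inE mnS orbT.
(* In any other order the minimum of [S] is at most the non-slack [g], hence below [sl i1]; so
   [Y i1] has a maximum [l]. *)
have Ysl : Y i1 (sl i1).
  by apply/YP => j ji; apply: leq_ltn_trans (mnmin _ _ gS) _; apply: sl_big; rewrite // eq_sym.
case: (@arg_maxnP X (sl i1) (Y i1) (c i1) Ysl) => l /YP Yl lmax.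
have lS : l \notin S.
  apply/negP => lS; have [i ii E] := k4 _ lS.
  have [ii1|ii1] := eqVneq i i1; last by have := Yl _ ii1; rewrite E ltnn.
  have : (c i0 (mn i0) < c i0 l)%N by apply: Yl; rewrite eq_sym.
  by rewrite -E ii1 mni1 ltnn.
have doml : dominating (l |: S).
  apply/dominatingP => y; have [/YP Yy|] := boolP (Y i1 y).
    exists i1 => x; rewrite !inE => /orP[/eqP ->|xS]; first by apply: lmax; apply/YP.
    have /dominatingP/(_ y)[i Hi] := domk.
    have [<-|ij] := eqVneq i i1; first by apply: Hi; rewrite inE xS orbT.
    by have := Yy _ ij; rewrite ltnNge Hi // inE mnS orbT.
  case/forallPn => i; rewrite negb_imply -leqNgt => /andP[ii le].
  exists i => x; rewrite !inE => /orP[/eqP ->|xS].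
    exact: leq_trans le (ltnW (Yl _ ii)).
  exact: leq_trans le (mnmin _ _ xS).
have kl : k != l.
  apply/eqP => kl; have : (c i0 (mn i0) < c i0 l)%N by apply: Yl; rewrite eq_sym.
  by rewrite -kl ltnNge ltnW // k1.
suff -> : [set k | (k \notin S) && dominating (k |: S)] = [set k; l] by rewrite cards2 kl.
apply/setP => y; rewrite !inE; apply/idP/idP; last first.
  by case/orP => /eqP ->; rewrite ?kS ?lS.
case/andP => yS domy; have [j0 [y1 y2 y3 y4]] := struct _ yS domy.
have [j00|j00] := eqVneq j0 i0.
  subst j0; apply/orP; left; apply/eqP/(@injc i0)/eqP; rewrite eqn_leq.
  by apply/andP; split; apply: max_of => //; apply/YP.
have [j01|j01] := eqVneq j0 i1.
  subst j0; apply/orP; right; apply/eqP/(@injc i1)/eqP; rewrite eqn_leq.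
  by apply/andP; split; [apply: lmax | apply: max_of domy _]; apply/YP.
(* An element owning a third order would make [mn] injective on [i0] and [i1], where its values
   coincide. *)
have := y3 i0 i1; rewrite !inE eq_sym j00 eq_sym j01 mni1 => /(_ isT isT erefl) E.
by rewrite E eqxx in i10.
Qed.

Lemma ordinal_cycle (S : {set X}) g : g \notin codom sl -> #|S|.+1 = n ->
  ~~ odd #|[set k | (k \notin S) && (dominating (k |: S) || (k |: S == slacks))]|.
Proof.
move=> gN cS; have [Ssub|/subsetPn[h hS]] := boolP (S \subset slacks).
  by rewrite (dominating_over_slack_face cS Ssub gN).
rewrite mem_slacks => hN.
have -> : [set k | (k \notin S) && (dominating (k |: S) || (k |: S == slacks))]
   = [set k | (k \notin S) && dominating (k |: S)].
  apply/setP => k; rewrite !inE; have [E|] := eqVneq (k |: S) slacks; last by rewrite orbF.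
  by move: hN; rewrite -mem_slacks -E inE hS orbT.
have [E|[k]] := set_0Vmem [set k | (k \notin S) && dominating (k |: S)].
  by rewrite E cards0.
by rewrite inE => /andP[kS dk]; rewrite (dominating_over_face cS hS hN kS dk).
Qed.
End Ordinal.

(** * Feasible bases of a nondegenerate linear system *)

Lemma exists_kernel (F : fieldType) (X Y : finType) (K : {set X}) (E : {set Y})
    (M : X -> Y -> F) : (#|E| < #|K|)%N ->
  exists z : X -> F, [/\ forall x, x \notin K -> z x = 0, exists x, z x != 0 &
    forall y, y \in E -> \sum_x z x * M x y = 0].
Proof.
move=> cEK.
pose B := \matrix_(i < #|K|, j < #|E|) M (enum_val i) (enum_val j).
have : kermx B != 0.
  by rewrite kermx_eq0 -row_leq_rank -ltnNge (leq_ltn_trans (rank_leq_col B)).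
case/rowV0Pn => v /sub_kermxP vB v0.
have [i vi] : exists i, v 0 i != 0.
  apply/existsP; apply: contra_neqT v0 => /existsPn H; apply/rowP => i.
  by apply/eqP; have := H i; rewrite negbK mxE.
have Ki : enum_val i \in K by apply: enum_valP.
pose z x := if x \in K then v 0 (enum_rank_in Ki x) else 0.
have zE j : z (enum_val j) = v 0 j by rewrite /z enum_valP enum_valK_in.
exists z; split => [x /negbTE xK||y yE]; first by rewrite /z xK.
  by exists (enum_val i); rewrite zE.
have := congr1 (fun A : 'rV_#|E| => A 0 (enum_rank_in yE y)) vB; rewrite !mxE => {}vB.
rewrite -[RHS]vB (bigID (mem K)) /= [X in _ + X]big1 ?addr0; last first.
  by move=> x /negbTE xK; rewrite /z xK mul0r.
rewrite big_enum_val /=; apply: eq_bigr => j _.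
by rewrite zE mxE enum_rankK_in.
Qed.

(** The ratio test of the simplex method: [s] is the minimum of [a t / b t] over the [t] with
    [b t > 0]. *)
Lemma ratio_test (R : realFieldType) (T : finType) (a b : T -> R) :
  (forall t, 0 <= a t) -> (forall t, 0 < b t -> 0 < a t) -> (exists t, 0 < b t) ->
  exists s, [/\ 0 < s, forall t, s * b t <= a t & exists2 t, 0 < b t & s * b t = a t].
Proof.
move=> a0 ab [t0 bt0].
case: (@arg_minP _ R T t0 (fun t => 0 < b t) (fun t => a t / b t) bt0) => t bt tmin.
exists (a t / b t); split; first by rewrite divr_gt0 // ab.
  move=> u; have [bu|bu] := ltrP 0 (b u).
    by rewrite -ler_pdivlMr //; apply: tmin.
  by apply: le_trans (a0 u); rewrite mulr_ge0_le0 // divr_ge0 // ltW.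
by exists t => //; rewrite divfK // gt_eqF.
Qed.

Section Cardinal.
Variables (R : realFieldType) (X : finType) (n : nat) (A : X -> 'I_n -> R).

Definition comb (w : X -> R) (i : 'I_n) : R := \sum_x w x * A x i.
Definition supp (w : X -> R) : {set X} := [set x | w x != 0].
(** Nondegeneracy. The signs of [w] are unrestricted, so that independence of the columns of a basis
    follows as well. *)
Definition generic (b : 'I_n -> R) : Prop :=
  forall w, comb w =1 b -> (n <= #|supp w|)%N.
Definition feasible (b : 'I_n -> R) (J : {set X}) : Prop :=
  exists w : X -> R, [/\ forall x, 0 <= w x, forall x, x \notin J -> w x = 0 & comb w =1 b].

Lemma comb_axpy (w z : X -> R) t i :
  comb (fun x => w x + t * z x) i = comb w i + t * comb z i.
Proof.
rewrite /comb mulr_sumr -big_split; apply: eq_bigr => x _ /=.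
by rewrite mulrDl mulrA.
Qed.

Lemma supp_sub (w : X -> R) (J : {set X}) :
  (forall x, x \notin J -> w x = 0) -> supp w \subset J.
Proof. by move=> H; apply/subsetP => x; rewrite inE; apply: contraNT => /H ->. Qed.

Variable b : 'I_n -> R.
Hypothesis gb : generic b.

Lemma generic_supp (w : X -> R) (J : {set X}) : (#|J| <= n)%N ->
  (forall x, x \notin J -> w x = 0) -> comb w =1 b -> supp w = J.
Proof.
move=> cJ H Hw; apply/eqP; rewrite eqEcard supp_sub //=.
exact: leq_trans cJ (gb Hw).
Qed.

(** Subtracting a multiple of a nonzero kernel vector would cancel a coordinate of [w] and represent
    [b] by fewer than [n] columns. *)
Lemma generic_kernel (w z : X -> R) (J : {set X}) : (#|J| <= n)%N ->
  (forall x, x \notin J -> w x = 0) -> comb w =1 b ->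
  (forall x, x \notin J -> z x = 0) -> comb z =1 (fun=> 0) -> z =1 (fun=> 0).
Proof.
move=> cJ wJ wb zJ z0 x; apply/eqP/negPn/negP => zx.
pose w' y := w y + (- (w x / z x)) * z y.
have w'b : comb w' =1 b by move=> i; rewrite comb_axpy z0 mulr0 addr0 wb.
have w'x : w' x = 0 by rewrite /w' mulNr divfK // subrr.
have xJ : x \in J by apply: contra_neqT zx => /zJ.
have : (#|supp w'| <= #|J :\ x|)%N.
  apply/subset_leq_card/supp_sub => y; rewrite !inE negb_and negbK.
  by case/orP => [/eqP ->//|yJ]; rewrite /w' (wJ y yJ) (zJ y yJ) mulr0 addr0.
move: (gb w'b) cJ; rewrite (cardsD1 x J) xJ => h1 h2 h3.
by have := leq_trans h2 (leq_trans h1 h3); rewrite add1n ltnn.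
Qed.

Hypothesis A0 : forall x i, 0 <= A x i.
Hypothesis Apos : forall x, exists i, 0 < A x i.

Lemma cardinal_cocycle (K : {set X}) : #|K| = n.+1 ->
  ~~ odd #|[set k in K | pbool (feasible b (K :\ k))]|.
Proof.
move=> cK.
have cKk k : k \in K -> (#|K :\ k| <= n)%N.
  by move=> kK; move: cK; rewrite (cardsD1 k) kK add1n => -[->].
have [->|[k]] := set_0Vmem [set k in K | pbool (feasible b (K :\ k))]; first by rewrite cards0.
rewrite inE => /andP[kK /pboolP[w [w0 wK wb]]].
have wsupp := generic_supp (cKk _ kK) wK wb.
have wk : w k = 0 by apply: wK; rewrite !inE eqxx.
have wpos x : x \in K -> x != k -> 0 < w x.
  move=> xK xk; rewrite lt_neqAle w0 andbT eq_sym.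
  by have : x \in supp w; [rewrite wsupp !inE xk xK | rewrite inE].
have [z [zK [x zx] z0]] : exists z : X -> R, [/\ forall x, x \notin K -> z x = 0,
    exists x, z x != 0 & forall y, y \in [set: 'I_n] -> \sum_x z x * A x y = 0].
  by apply: exists_kernel; rewrite cardsT card_ord cK.
have {}z0 : comb z =1 (fun=> 0) by move=> i; apply: z0; rewrite inE.
have zk : z k != 0.
  apply: contraNneq zx => zk; apply/eqP.
  apply: (generic_kernel (cKk _ kK) wK wb) => // y; rewrite !inE negb_and negbK.
  by case/orP => [/eqP ->//|/zK].
pose u y := z y / z k.
have uk : u k = 1 by rewrite /u divff.
have uK y : y \notin K -> u y = 0 by move=> yK; rewrite /u zK // mul0r.
have u0 : comb u =1 (fun=> 0).
  move=> i; rewrite /comb (eq_bigr (fun y => (z y * A y i) / z k)); last first.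
    by move=> y _; rewrite /u mulrAC.
  by rewrite -mulr_suml; have := z0 i; rewrite /comb => ->; rewrite mul0r.
have [s [s0 sle [j uj sj]]] : exists s, [/\ 0 < s, forall t, s * - u t <= w t &
    exists2 t, 0 < - u t & s * - u t = w t].
  apply: ratio_test => // [t ut|].
    apply: wpos; first by apply: contra_ltT ut => /uK ->; rewrite oppr0.
    by apply: contra_ltN ut => /eqP ->; rewrite uk lerN10.
  (* If [u] had no negative coordinate, [u k = 1] would make its combination positive in a row where
     column [k] is positive. *)
  apply/existsP; apply: contraT => /existsPn H; have [i Ai] := Apos k.
  have : comb u i > 0.
    rewrite /comb (bigD1 k) //= uk mul1r; apply: ltr_wpDr => //.
    apply: sumr_ge0 => y _; apply: mulr_ge0 => //.
    by rewrite leNgt -oppr_gt0; apply: H.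
  by rewrite u0 ltxx.
pose w1 y := w y + s * u y.
have w10 y : 0 <= w1 y by have := sle y; rewrite /w1 mulrN; lra.
have w1j : w1 j = 0 by rewrite /w1; move: sj; rewrite mulrN; lra.
have w1K y : y \notin K -> w1 y = 0.
  by move=> yK; rewrite /w1 uK // wK ?mulr0 ?addr0 // !inE negb_and yK orbT.
have w1b : comb w1 =1 b by move=> i; rewrite comb_axpy u0 mulr0 addr0 wb.
have jK : j \in K by apply: contra_ltT uj => /uK ->; rewrite oppr0.
have w1Kj y : y \notin K :\ j -> w1 y = 0.
  by rewrite !inE negb_and negbK => /orP[/eqP ->|/w1K].
have w1supp := generic_supp (cKk _ jK) w1Kj w1b.
have jk : k != j by apply: contra_ltN uj => /eqP <-; rewrite uk lerN10.
suff -> : [set k in K | pbool (feasible b (K :\ k))] = [set k; j] by rewrite cards2 jk.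
apply/setP => l; rewrite !inE; apply/idP/idP; last first.
  case/orP => /eqP ->; rewrite ?kK ?jK /=; apply/pboolP; first by exists w.
  by exists w1.
case/andP => lK /pboolP[w2 [w20 w2K w2b]].
have w2l : w2 l = 0 by apply: w2K; rewrite !inE eqxx.
(* The difference of the two sides is a kernel vector supported on [K :\ k], hence zero. *)
have w2E y : w2 y = w y + w2 k * u y.
  suff : (w2 y + -1 * w y) + (- w2 k) * u y = 0 by lra.
  move: y; apply: (generic_kernel (cKk _ kK) wK wb) => [y|i]; last first.
    by rewrite !comb_axpy u0 w2b wb; lra.
  rewrite !inE negb_and negbK => /orP[/eqP ->|yK]; first by rewrite uk wk; lra.
  by rewrite uK // (wK y) ?(w2K y) ?inE ?negb_and ?yK ?orbT // !mulr0 !addr0.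
have [w2k|w2k] := eqVneq (w2 k) 0.
  apply/orP; left; apply: contraT => lk.
  by have := wpos l lK lk; have := w2E l; rewrite w2l w2k; lra.
(* Coordinate [l] vanishes at [w2] and does not increase along [u], so it cannot be positive at the
   far end [w1]. *)
apply/orP; right; apply: contraT => lj.
have w2kpos : 0 < w2 k by rewrite lt_neqAle eq_sym w2k w20.
have h1 : w2 k <= s.
  have := w20 j; rewrite w2E -sj => h; have : (s - w2 k) * - u j >= 0 by lra.
  by rewrite pmulr_lge0 //; lra.
have : 0 < w1 l.
  rewrite lt_neqAle w10 andbT eq_sym.
  by have : l \in supp w1; [rewrite w1supp !inE lj lK | rewrite inE].
have wl := w0 l; have := w2E l; rewrite w2l /w1 => h2 h3.
have hu : u l <= 0.
  by rewrite -(pmulr_rle0 _ w2kpos); lra.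
have : (s - w2 k) * - u l >= 0 by apply: mulr_ge0; lra.
lra.
Qed.
End Cardinal.

(** * Perturbation of the right-hand side *)

Lemma fin_pos_bound (R : realFieldType) (T : finType) (P : T -> R -> Prop) :
  (forall t, exists2 e, 0 < e & forall a, 0 < a -> a <= e -> P t a) ->
  exists2 e, 0 < e & forall t a, 0 < a -> a <= e -> P t a.
Proof.
move=> H.
have [e He] : exists e : T -> R, forall t, 0 < e t /\ forall a, 0 < a -> a <= e t -> P t a.
  apply: (fin_all_exists (P := fun t e => 0 < e /\ forall a, 0 < a -> a <= e -> P t a)) => t.
  by have [e e0 He] := H t; exists e.
exists (\big[Num.min/1]_t e t).
  by apply: (big_ind (fun x => 0 < x)) => // [x y x0 y0|t _]; [rewrite lt_min x0 | have [] := He t].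
move=> t a a0 ae; apply: (He t).2 => //; apply: le_trans ae _.
by rewrite (bigD1 t) //= ge_min lexx.
Qed.

Lemma exists_nonroot (R : realFieldType) (q : {poly R}) (e : R) : q != 0 -> 0 < e ->
  exists a, [/\ 0 < a, a <= e & ~~ root q a].
Proof.
move=> q0 e0; pose s := [seq e / m.+1%:R | m <- iota 0 (size q)].
have us : uniq s.
  rewrite map_inj_uniq ?iota_uniq // => m k /(mulfI (lt0r_neq0 e0)) /invr_inj /eqP.
  by rewrite eqr_nat => /eqP [].
have /allPn[a /mapP[m _ ->] ra] : ~~ all (root q) s.
  apply/negP => rs; have := max_poly_roots q0 rs us.
  by rewrite size_map size_iota ltnn.
exists (e / m.+1%:R); split => //; first by rewrite divr_gt0 // ltr0n.
by rewrite ler_pdivrMr ?ltr0n // ler_peMr ?ler1n // ltW.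
Qed.

Section Perturbation.
Variables (R : realFieldType) (X : finType) (n : nat) (A : X -> 'I_n -> R).

(** Fewer than [n] columns are annihilated by a nonzero functional [a]. If they span the right-hand
    side, [e] is a root of the polynomial with terms [a i *: (1 - 'X^(i.+1))], nonzero because the
    exponents are distinct. So [e] has only to avoid the roots of a finite product. *)
Lemma generic_perturbation (e0 : R) : 0 < e0 ->
  exists e, [/\ 0 < e, e <= e0 & generic A (fun i : 'I_n => 1 - e ^+ i.+1)].
Proof.
move=> e00.
have [p Hp] : exists p : {set X} -> {poly R}, forall J, p J != 0 /\
    ((#|J| < n)%N -> forall w e, (forall x, x \notin J -> w x = 0) ->
      comb A w =1 (fun i : 'I_n => 1 - e ^+ i.+1) -> root (p J) e).
  apply: (fin_all_exists (P := fun (J : {set X}) (q : {poly R}) => q != 0 /\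
    ((#|J| < n)%N -> forall w e, (forall x, x \notin J -> w x = 0) ->
      comb A w =1 (fun i : 'I_n => 1 - e ^+ i.+1) -> root q e))) => J.
  have [cJ|cJ] := ltnP #|J| n; last first.
    by exists 1; rewrite oner_neq0.
  have [a [_ [i ai] aJ]] : exists a : 'I_n -> R,
     [/\ forall x, x \notin [set: 'I_n] -> a x = 0, exists x, a x != 0 &
      forall x, x \in J -> \sum_i a i * A x i = 0].
    by apply: (exists_kernel (fun i x => A x i)); rewrite cardsT card_ord.
  exists (\sum_i a i *: (1 - 'X^(i.+1))); split => [|_ w e wJ we].
    apply: contraNneq ai => /(congr1 (fun q : {poly R} => q`_i.+1)) /eqP.
    rewrite coef0 coef_sum (bigD1 i) //= big1 => [|j ji].
      rewrite coefZ coefB coefXn coef1 eqxx /= addr0 sub0r mulrN1 oppr_eq0.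
      by [].
    have ij : (i == j :> nat) = false by rewrite eq_sym; apply: negbTE ji.
    by rewrite coefZ coefB coefXn coef1 /= eqSS ij subrr mulr0.
  rewrite /root horner_sum; apply/eqP.
  rewrite (eq_bigr (fun i => \sum_x w x * (a i * A x i))); last first.
    move=> j _; rewrite !hornerE -we /comb mulr_sumr.
    by apply: eq_bigr => x _; rewrite mulrCA.
  rewrite exchange_big big1 //= => x _; rewrite -mulr_sumr.
  have [xJ|xJ] := boolP (x \in J); first by rewrite aJ // mulr0.
  by rewrite wJ // mul0r.
have q0 : \prod_J p J != 0 by apply/prodf_neq0 => J _; have [] := Hp J.
have [e [ep ee re]] := exists_nonroot q0 e00.
exists e; split => // w we; rewrite leqNgt; apply/negP => cw.
move: re; rewrite /root horner_prod; apply/negP; rewrite negbK.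
apply/prodf_eq0 => /=; exists (supp w) => //.
have [_ /(_ cw w e _ we)] := Hp (supp w); apply.
by move=> x; rewrite inE negbK => /eqP.
Qed.

Lemma comb_push (I : finType) (e : I -> X) (v : I -> R) i :
  comb A (fun x => \sum_(j | e j == x) v j) i = \sum_j v j * A (e j) i.
Proof.
rewrite (partition_big e predT) //=; apply: eq_bigr => x _.
by rewrite mulr_suml; apply: eq_bigr => j /eqP ->.
Qed.

(** A negative coordinate of the solution for the constant 1 would stay negative for every [b] close
    enough to it. There are finitely many bases, so one threshold serves them all. *)
Lemma feasible_limit : exists2 e0 : R, 0 < e0 &
  forall e b, 0 < e -> e <= e0 -> (forall i, `|1 - b i| <= e) -> generic A b ->
  forall J : {set X}, #|J| = n -> feasible A b J -> feasible A (fun=> 1) J.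
Proof.
pose M (f : {ffun 'I_n -> X}) : 'M[R]_n := \matrix_(j, i) A (f j) i.
have [e0 e0p He0] : exists2 e0 : R, 0 < e0 &
    forall (t : {ffun 'I_n -> X} * 'I_n) e, 0 < e -> e <= e0 ->
    \sum_j invmx (M t.1) j t.2 < 0 ->
    e * \sum_j `|invmx (M t.1) j t.2| < - \sum_j invmx (M t.1) j t.2.
  apply: fin_pos_bound => -[f i] /=.
  set u := \sum_j _; set B := \sum_j `|_|.
  have B0 : 0 <= B by apply: sumr_ge0.
  have [u0|u0] := ltrP u 0; last by exists 1.
  exists (- u / (B + 1)); first by rewrite divr_gt0; lra.
  move=> e ep; rewrite ler_pdivlMr; last by lra.
  by lra.
exists e0 => // e b ep ee eb gb J cJ [w [w0 wJ wb]].
pose f := [ffun i : 'I_n => enum_val (cast_ord (esym cJ) i)].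
have finj : injective f.
  by move=> i j; rewrite !ffunE => /enum_val_inj/cast_ord_inj.
have fJ : f @: setT = J.
  apply/eqP; rewrite eqEcard card_imset // cardsT card_ord cJ leqnn andbT.
  by apply/subsetP => x /imsetP[i _ ->]; rewrite ffunE enum_valP.
have pushJ (v : 'I_n -> R) x : x \notin J -> \sum_(j | f j == x) v j = 0.
  move=> xJ; apply: big1 => j /eqP fj; move: xJ; rewrite -fJ -fj.
  by rewrite imset_f.
(* Genericity makes the columns of [J] independent. *)
have Mu : M f \in unitmx.
  rewrite -row_free_unit -kermx_eq0; apply: contraT => /rowV0Pn[v /sub_kermxP vM v0].
  case/negP: v0; apply/eqP/rowP => i; rewrite mxE.
  have : \sum_(j | f j == f i) v 0 j = 0.
    apply: (generic_kernel gb _ wJ wb (z := fun x => \sum_(j | f j == x) v 0 j)).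
    - by rewrite cJ.
    - by move=> x xJ; apply: pushJ.
    move=> k; rewrite comb_push.
    have := congr1 (fun B : 'rV_n => B 0 k) vM; rewrite !mxE => {2}<-.
    by apply: eq_bigr => j _; rewrite mxE.
  by rewrite (big_pred1 i) // => j; rewrite /= (inj_eq finj).
pose v : 'rV[R]_n := \row_j w (f j).
have vM : v *m M f = \row_i b i.
  apply/rowP => i; rewrite !mxE -wb /comb (bigID (mem J)) /= [X in _ = _ + X]big1 ?addr0.
    rewrite -fJ big_imset /=; last by move=> ? ? _ _; apply: finj.
    by apply: eq_big => [j|j _]; rewrite ?inE ?mxE.
  by move=> x xJ; rewrite wJ // mul0r.
have vE : v = \row_i b i *m invmx (M f) by rewrite -vM mulmxK.
pose u : 'rV[R]_n := const_mx 1 *m invmx (M f).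
have uE i : u 0 i = \sum_j invmx (M f) j i.
  by rewrite mxE; apply: eq_bigr => j _; rewrite !mxE mul1r.
have u0 i : 0 <= u 0 i.
  rewrite leNgt; apply/negP; rewrite uE => ui.
  have := He0 (f, i) e ep ee ui; apply/negP; rewrite -leNgt /=.
  have vi : 0 <= \sum_j b j * invmx (M f) j i.
    have := w0 (f i); have : v 0 i = w (f i) by rewrite mxE.
    rewrite vE mxE => <-; rewrite (eq_bigr (fun j => b j * invmx (M f) j i)) //.
    by move=> j _; rewrite mxE.
  apply: le_trans (_ : \sum_j (b j - 1) * invmx (M f) j i <= _); last first.
    rewrite mulr_sumr; apply: ler_sum => j _; apply: le_trans (ler_norm _) _.
    by rewrite normrM distrC ler_wpM2r.
  rewrite [X in _ <= X](eq_bigr (fun j => b j * invmx (M f) j i - invmx (M f) j i)).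
    by rewrite sumrB /=; lra.
  by move=> j _; rewrite mulrBl mul1r.
exists (fun x => \sum_(j | f j == x) u 0 j); split.
- by move=> x; apply: sumr_ge0.
- by move=> x xJ; apply: pushJ.
move=> i; rewrite comb_push.
have <- : (u *m M f) 0 i = 1 by rewrite mulmxKV // mxE.
by rewrite mxE; apply: eq_bigr => j _; rewrite [M f j i]mxE.
Qed.
End Perturbation.

(** The set of slacks belongs to both families, so by parity they share another member. The
    injection [s] lets a slack carry the unit vector of a different index. *)
Theorem scarf (R : realFieldType) (X : finType) (n : nat) (c : 'I_n -> X -> nat)
    (sl : 'I_n -> X) (s : 'I_n -> 'I_n) (A : X -> 'I_n -> R) (g : X) :
  (0 < n)%N -> (forall i, injective (c i)) -> injective sl ->
  (forall i x, (c i (sl i) <= c i x)%N) ->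
  (forall i j x, j != i -> x \notin codom sl -> (c i x < c i (sl j))%N) ->
  g \notin codom sl -> injective s ->
  (forall x i, 0 <= A x i) -> (forall x, exists i, 0 < A x i) ->
  (forall j i, A (sl j) i = (i == s j)%:R) ->
  exists J : {set X}, dominating c J /\ feasible A (fun=> 1) J.
Proof.
move=> n0 injc injsl slmin slbig gN injs A0 Apos Asl.
have [e0 e0p He0] := feasible_limit A.
(* The bound 1 on [e] keeps [b] nonnegative, which makes the slacks feasible. *)
have [e [ep ee gb]] : exists e, [/\ 0 < e, e <= Num.min e0 1 &
    generic A (fun i : 'I_n => 1 - e ^+ i.+1)].
  by apply: generic_perturbation; rewrite lt_min e0p ltr01.
move: ee; rewrite le_min => /andP[ee0 e1].
set b := (fun i : 'I_n => _) in gb.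
have eX (i : 'I_n) : 0 <= e ^+ i.+1 <= e.
  have e_ge0 := ltW ep.
  by rewrite exprn_ge0 //= exprS ler_piMr // exprn_ile1.
have b0 i : 0 <= b i by have := eX i; rewrite /b; lra.
have be i : `|1 - b i| <= e.
  by have /andP[h1 h2] := eX i; rewrite /b opprB addrC subrK ger0_norm.
have cs : #|slacks sl| = n by rewrite card_imset // card_ord.
pose O J := dominating c J || (J == slacks sl).
pose C J := pbool (feasible A b J).
have par := cocycle_cycle_parity (O := O) (C := C)
  (fun K cK => cardinal_cocycle gb A0 Apos cK)
  (fun S cS => ordinal_cycle injc injsl slmin slbig gN cS) n0.
have slin : slacks sl \in [set J : {set X} | [&& #|J| == n, O J & C J]].
  rewrite inE cs eqxx /O eqxx orbT /=; apply/pboolP.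
  exists (fun x => \sum_(j | sl j == x) b (s j)); split.
  - by move=> x; apply: sumr_ge0.
  - move=> x xN; apply: big1 => j /eqP E; move: xN.
    by rewrite -E imset_f.
  move=> i; rewrite comb_push; have [t st ts] := injF_bij injs.
  rewrite (bigD1 (t i)) //= ts Asl ts eqxx mulr1 big1 ?addr0 // => j ji.
  rewrite Asl; case: eqP => [E|_]; last by rewrite mulr0.
  by move: ji; rewrite E st eqxx.
move: par; rewrite (cardsD1 (slacks sl)) slin add1n /= negbK => par.
have [E|[J]] := set_0Vmem ([set J : {set X} | [&& #|J| == n, O J & C J]] :\ slacks sl).
  by rewrite E cards0 in par.
rewrite !inE => /and4P[Js /eqP cJ OJ /pboolP CJ].
exists J; split; first by move: OJ; rewrite /O (negbTE Js) orbF.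
exact: He0 ep ee0 be gb _ cJ CJ.
Qed.

(** * Fractional matchings of hypergraphs of rank [d] *)

Section Furedi.
Variables (R : realFieldType) (V E : finType) (L : E -> {set V}).

Definition deg (w : E -> R) (v : V) : R := \sum_(e | v \in L e) w e.
Definition frac (w : E -> R) : Prop := (forall e, 0 <= w e) /\ (forall v, deg w v <= 1).
Definition tight (w : E -> R) : {set V} := [set v | deg w v == 1].

Lemma deg_axpy (w z : E -> R) t v :
  deg (fun e => w e + t * z e) v = deg w v + t * deg z v.
Proof. by rewrite /deg mulr_sumr -big_split. Qed.

Lemma sum_deg (w : E -> R) (B : {set V}) :
  \sum_(v in B) deg w v = \sum_e w e * #|B :&: L e|%:R.
Proof.
rewrite /deg (exchange_big_dep predT) //=; apply: eq_bigr => e _.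
rewrite -sum1_card natr_sum mulr_sumr.
by apply: eq_big => [v|v _]; rewrite ?inE ?mulr1.
Qed.

(** With more positive weights than tight vertices, some nonzero [z] on the support preserves all
    tight degrees. Moving along it, with the sign that does not lower the total, until a weight
    vanishes or a new vertex becomes tight decreases the measure [m]. *)
Lemma frac_purify (w : E -> R) : frac w -> (forall e, w e != 0 -> L e != set0) ->
  exists w', [/\ frac w', supp w' \subset supp w, \sum_e w e <= \sum_e w' e &
                 (#|supp w'| <= #|tight w'|)%N].
Proof.
have [m] := ubnP (#|supp w| + #|~: tight w|)%N.
elim: m w => // m IH w lem [w0 w1] wL.
have [le|lt] := leqP #|supp w| #|tight w|; first by exists w.
have [z [zN [e1 ze1] zt]] := exists_kernel (fun e v => (v \in L e)%:R : R) lt.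
have degE (u : E -> R) v : \sum_e u e * (v \in L e)%:R = deg u v.
  rewrite /deg [RHS]big_mkcond; apply: eq_bigr => e _.
  by case: (v \in L e); rewrite ?mulr1 ?mulr0.
wlog zs : z zN e1 ze1 zt / 0 <= \sum_e z e.
  have [h H|h H] := lerP 0 (\sum_e z e); first exact: (H z zN e1 ze1 zt h).
  apply: (H (fun e => - z e) _ e1) => //.
  - by move=> x /zN ->; rewrite oppr0.
  - by rewrite oppr_eq0.
  - move=> y /zt h'; rewrite (eq_bigr (fun x => - (z x * (y \in L x)%:R))).
      by rewrite sumrN h' oppr0.
    by move=> x _; rewrite mulNr.
  - by rewrite sumrN oppr_ge0 ltW.
have {}zt v : v \in tight w -> deg z v = 0 by move=> /zt; rewrite degE.
have wpos e : z e != 0 -> 0 < w e.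
  move=> ze; rewrite lt_neqAle w0 andbT eq_sym.
  by have : e \in supp w; [apply: contraT => /zN z0; rewrite z0 eqxx in ze | rewrite inE].
pose a (t : E + V) := match t with inl e => w e | inr v => 1 - deg w v end.
pose b (t : E + V) := match t with inl e => - z e | inr v => deg z v end.
have [s [s0 sle [t bt st]]] : exists s, [/\ 0 < s, forall t, s * b t <= a t &
    exists2 t, 0 < b t & s * b t = a t].
  apply: ratio_test.
  - by case=> [e|v] /=; rewrite ?subr_ge0.
  - case=> [e|v] /= h; first by apply: wpos; rewrite -oppr_eq0 gt_eqF.
    rewrite subr_gt0 lt_neqAle w1 andbT.
    by apply: contraTneq h => dv; rewrite zt ?ltxx // inE dv.
  (* Some constraint blocks the move: if no weight decreases, the degree grows at every vertex of
     [L e1]. *)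
  - have [/existsP[e ze]|/existsPn zpos] := boolP [exists e, z e < 0].
      by exists (inl e) => /=; rewrite oppr_gt0.
    have /set0Pn[v vL] : L e1 != set0 by apply: wL; rewrite gt_eqF // wpos.
    have {}zpos e : 0 <= z e by rewrite leNgt.
    exists (inr v) => /=; rewrite /deg (bigD1 e1) //=.
    apply: ltr_wpDr; first exact: sumr_ge0.
    by rewrite lt_neqAle eq_sym ze1 zpos.
pose w' e := w e + s * z e.
have w'0 e : 0 <= w' e by have := sle (inl e); rewrite /= /w' mulrN; lra.
have w'1 v : deg w' v <= 1 by have := sle (inr v); rewrite /= deg_axpy; lra.
have ss : supp w' \subset supp w.
  apply: supp_sub => e; rewrite !inE negbK /w' => /eqP we.
  by rewrite zN ?inE ?we ?eqxx // mulr0 addr0.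
have tt : tight w \subset tight w'.
  by apply/subsetP => v vt; rewrite inE deg_axpy zt // mulr0 addr0; rewrite inE in vt.
have ltm : (#|supp w'| + #|~: tight w'| < #|supp w| + #|~: tight w|)%N.
  have l1 := subset_leq_card ss.
  have l2 : (#|~: tight w'| <= #|~: tight w|)%N by apply: subset_leq_card; rewrite setCS.
  case: t bt st => [e|v] /= bt st.
    suff : (#|supp w'| < #|supp w|)%N by move: l2; clear; lia.
    apply: proper_card; rewrite properE ss /=; apply/subsetPn; exists e.
      by rewrite inE gt_eqF // wpos // -oppr_eq0 gt_eqF.
    by rewrite inE negbK /w'; apply/eqP; move: st; rewrite mulrN; lra.
  suff : (#|~: tight w'| < #|~: tight w|)%N by move: l1; clear; lia.
  apply: proper_card; rewrite properE setCS tt /=; apply/subsetPn; exists v.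
    by rewrite inE; apply: contraTN bt => /zt ->; rewrite ltxx.
  by rewrite !inE negbK deg_axpy; apply/eqP; lra.
have [||w'' [f s'' le'' c'']] := IH w' (leq_trans ltm lem).
- by split.
- move=> e we; apply: wL; have : e \in supp w by apply: (subsetP ss); rewrite inE.
  by rewrite inE.
exists w''; split => //; first exact: subset_trans s'' ss.
apply: le_trans le''; rewrite big_split /= -mulr_sumr lerDl.
by rewrite mulr_ge0 // ltW.
Qed.

(** Induction by deletion. After purification the heaviest edge [e] has weight at least [1/d], and
    the edges meeting it, itself included, weigh at most [d - 1 + 1/d] together. They are removed
    and [e] joins the matching. *)
Lemma furedi (d : nat) (w : E -> R) : frac w ->
  (forall e, w e != 0 -> (0 < #|L e| <= d)%N) ->
  exists M : {set E}, [/\ M \subset supp w,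
    {in M &, forall e f, e != f -> [disjoint L e & L f]} &
    d%:R * \sum_e w e <= (d ^ 2 - d + 1)%:R * #|M|%:R].
Proof.
have [m] := ubnP #|supp w|; elim: m w => // m IH w lem fw wL.
have [sw|[e0 e0s]] := set_0Vmem (supp w).
  exists set0; split; rewrite ?sub0set //; first by move=> ?; rewrite inE.
  rewrite cards0 mulr0 big1 ?mulr0 // => e _; apply/eqP.
  by have := in_set0 e; rewrite -sw inE => /negbFE.
have [w' [[w'0 w'1] ss le c]] : exists w', [/\ frac w', supp w' \subset supp w,
    \sum_e w e <= \sum_e w' e & (#|supp w'| <= #|tight w'|)%N].
  by apply: frac_purify => // e /wL; rewrite -card_gt0 => /andP[].
have w'L e : w' e != 0 -> (0 < #|L e| <= d)%N.
  move=> we; apply: wL; have : e \in supp w by apply: (subsetP ss); rewrite inE.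
  by rewrite inE.
have Wpos : 0 < \sum_e w' e.
  apply: lt_le_trans le; rewrite (bigD1 e0) //=; case: fw => w0 _.
  apply: ltr_wpDr; first exact: sumr_ge0.
  by rewrite lt_neqAle w0 andbT eq_sym; move: e0s; rewrite inE.
case: (@arg_maxP _ R E e0 predT w' isT) => e _ emax.
have emaxw f : w' f <= w' e by apply: emax.
have we : 0 < w' e.
  rewrite lt_neqAle w'0 andbT; apply: contraTneq Wpos => h; rewrite -leNgt.
  by apply: sumr_le0 => f _; rewrite h emaxw.
have /andP[Le0 Led] : (0 < #|L e| <= d)%N by apply: w'L; rewrite gt_eqF.
(* The total is at most [#|supp w'| * w' e], hence at most [#|tight w'| * w' e], hence at most
   [d * w' e] times itself. *)
have dwe : 1 <= d%:R * w' e.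
  have h1 : \sum_f w' f <= #|supp w'|%:R * w' e.
    rewrite (bigID (mem (supp w'))) /= [X in _ + X]big1 ?addr0.
      rewrite mulr_natl -sumr_const; exact: ler_sum.
    by move=> f; rewrite inE negbK => /eqP.
  have h2 : #|tight w'|%:R <= d%:R * \sum_f w' f.
    rewrite -sum1_card natr_sum.
    rewrite (eq_bigr (deg w')); last by move=> v; rewrite inE => /eqP ->.
    rewrite sum_deg mulr_sumr; apply: ler_sum => f _; rewrite mulrC.
    have [->|wf] := eqVneq (w' f) 0; first by rewrite !mulr0.
    rewrite ler_wpM2r // ler_nat.
    have /andP[_] := w'L _ wf; apply: leq_trans.
    by apply/subset_leq_card/subsetIr.
  have h3 : #|supp w'|%:R <= #|tight w'|%:R :> R by rewrite ler_nat.
  have h4 : \sum_f w' f <= (d%:R * \sum_f w' f) * w' e.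
    by apply: le_trans h1 _; rewrite ler_wpM2r // (le_trans h3).
  by rewrite -(ler_pM2r Wpos) mul1r mulrAC.
pose w2 f := if [disjoint L e & L f] then w' f else 0.
have s2 : supp w2 \subset supp w' :\ e.
  apply: supp_sub => f; rewrite !inE negb_and !negbK /w2 => /orP[]/eqP ->.
    by rewrite -setI_eq0 setIid -cards_eq0 gtn_eqF.
  by case: ifP.
have e_s : e \in supp w' by rewrite inE gt_eqF.
have [|||M [Ms Md Mle]] := IH w2.
- apply: leq_trans (_ : (#|supp w'| <= m)%N).
    by rewrite [X in (_ < X)%N](cardsD1 e) e_s ltnS; apply: subset_leq_card s2.
  by apply: leq_trans (subset_leq_card ss) _; rewrite -ltnS.
- split=> [f|v]; first by rewrite /w2; case: ifP.
  apply: le_trans (w'1 v); apply: ler_sum => f _; rewrite /w2.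
  by case: ifP.
- by move=> f; rewrite /w2; case: ifP => [_ /w'L //|]; rewrite eqxx.
have eM : e \notin M by apply/negP => /(subsetP Ms)/(subsetP s2); rewrite !inE eqxx.
have Mdis f : f \in M -> [disjoint L e & L f].
  by move=> /(subsetP Ms); rewrite inE /w2; case: ifP => //; rewrite eqxx.
exists (e |: M); split.
- rewrite subUset sub1set (subsetP ss) //=.
  by apply: subset_trans (subset_trans s2 _) => //; apply: subset_trans (subsetDl _ _) ss.
- move=> f g; rewrite !inE => /orP[/eqP ->|fM] /orP[/eqP ->|gM]; rewrite ?eqxx // => fg.
  + exact: Mdis.
  + by rewrite disjoint_sym; apply: Mdis.
  + exact: Md.
rewrite cardsU1 eM (natrD _ true) mulrDr mulr1.
pose m' := \sum_(f | ~~ [disjoint L e & L f]) w' f.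
have split2 : \sum_f w' f = \sum_f w2 f + m'.
  rewrite (bigID (fun f => [disjoint L e & L f])) /=; congr (_ + _).
  by rewrite big_mkcond.
(* Summing degrees over [L e] counts [e] exactly [#|L e|] times and every other edge meeting it at
   least once. *)
have hm : m' + (#|L e|%:R - 1) * w' e <= #|L e|%:R.
  have : \sum_(v in L e) deg w' v <= #|L e|%:R.
    by rewrite -sum1_card natr_sum; apply: ler_sum.
  apply: le_trans; rewrite sum_deg (bigD1 e) //= setIid.
  have dee : ~~ [disjoint L e & L e].
    by rewrite -setI_eq0 setIid -cards_eq0 -lt0n.
  rewrite /m' (bigD1 e) //=.
  suff : \sum_(f | ~~ [disjoint L e & L f] && (f != e)) w' f <=
         \sum_(i | i != e) w' i * #|L e :&: L i|%:R by lra.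
  rewrite big_mkcondl /=; apply: ler_sum => f _; case: ifP => [|_]; last first.
    by rewrite mulr_ge0.
  by rewrite -setI_eq0 -card_gt0 => h; rewrite ler_peMr // ler1n.
have dd : (d <= d ^ 2)%N by rewrite -{1}[d]muln1 leq_mul2l (leq_trans Le0) ?orbT.
have s1 : (1 : R) <= #|L e|%:R by rewrite ler1n.
have sd : #|L e|%:R <= d%:R :> R by rewrite ler_nat.
have d1 : 1 <= d%:R :> R by lra.
(* The extreme case is [d * w' e = 1] and [#|L e| = d]. *)
have hdm : d%:R * m' <= d%:R ^+ 2 - d%:R + 1.
  have k1 : d%:R * m' <= d%:R * (#|L e|%:R - (#|L e|%:R - 1) * w' e).
    by rewrite ler_wpM2l //; lra.
  have k2 : 0 <= (#|L e|%:R - 1) * (d%:R * w' e - 1) by rewrite mulr_ge0 //; lra.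
  have k3 : 0 <= (d%:R - #|L e|%:R) * (d%:R - 1) :> R by rewrite mulr_ge0 //; lra.
  nra.
have -> : (d ^ 2 - d + 1)%:R = d%:R ^+ 2 - d%:R + 1 :> R.
  by rewrite natrD natrB // natrX.
have := Mle; rewrite natrD natrB // natrX => {}Mle.
have : d%:R * \sum_e w e <= d%:R * \sum_e w' e by rewrite ler_wpM2l.
rewrite split2 mulrDr => h.
apply: le_trans h _; lra.
Qed.
End Furedi.

(** * The grid on the simplex *)

Section Grid.
Variables (k N : nat).
Local Notation n := k.+1.

Definition grid := {x : {ffun 'I_n -> 'I_N.+1} | (\sum_i x i == N)%N}.
Definition gval (x : grid) (i : 'I_n) : nat := val x i.

Lemma sum_gval x : (\sum_i gval x i = N)%N.
Proof. by apply/eqP; case: x. Qed.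

Lemma grid_of (f : 'I_n -> nat) : (\sum_i f i = N)%N -> exists x, gval x =1 f.
Proof.
move=> Hf; have lef i : (f i <= N)%N by rewrite -Hf (bigD1 i) // leq_addr.
pose x0 : {ffun 'I_n -> 'I_N.+1} := [ffun i => inord (f i)].
have H : (\sum_i x0 i == N)%N.
  by apply/eqP; rewrite -[RHS]Hf; apply: eq_bigr => i _; rewrite ffunE inordK // ltnS.
by exists (exist (fun x : {ffun 'I_n -> 'I_N.+1} => (\sum_i x i == N)%N) x0 H) => i;
  rewrite /gval /= ffunE inordK // ltnS.
Qed.

Local Notation X := ('I_n + grid)%type.

(** Order [i] lists its own slack, then the grid by coordinate [i] with ties broken by rank, then
    the other slacks. *)
Definition key (i : 'I_n) (p : X) : nat :=
  match p with
  | inl j => if j == i then 0 else (N.+1 * #|{: grid}|).+1 + j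
  | inr x => (gval x i * #|{: grid}| + enum_rank x).+1
  end%N.

Lemma key_inr_lt i x : (key i (inr x) < (N.+1 * #|{: grid}|).+1)%N.
Proof.
have aux a r c : (a <= N -> r < c -> a * c + r < N.+1 * c)%N by clear; nia.
by rewrite /= ltnS; apply: aux (ltn_ord _); rewrite -ltnS ltn_ord.
Qed.

Lemma key_inj i : injective (key i).
Proof.
move=> [j|x] [l|y].
- rewrite /=; case: eqP => [->|_]; case: eqP => [->|_] //.
  by move=> /addnI /val_inj ->.
- move=> E; have := key_inr_lt i y; rewrite -E; move: E => /=.
  by case: ifP => // _ _; rewrite ltnNge leq_addr.
- move=> E; have := key_inr_lt i x; rewrite E; move: E => /=.
  by case: ifP => // _ _; rewrite ltnNge leq_addr.
move=> /= [E]; congr inr; apply: enum_rank_inj; apply: val_inj => /=.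
have := ltn_ord (enum_rank x); have := ltn_ord (enum_rank y).
have := congr1 (modn ^~ #|{: grid}|) E; rewrite !modnMDl => + ly lx.
by rewrite !modn_small.
Qed.

Lemma key_gval i x y : (key i (inr x) <= key i (inr y))%N -> (gval x i <= gval y i)%N.
Proof.
have aux a b r s c : (r < c -> s < c -> a * c + r <= b * c + s -> a <= b)%N by clear; nia.
by rewrite /= ltnS; apply: aux; apply: ltn_ord.
Qed.

Lemma grid_inhabited : exists x : grid, True.
Proof.
have [|x _] := @grid_of (fun i => if i == ord0 then N else 0%N); last by exists x.
by rewrite (bigD1 ord0) //= big1 ?addn0 // => i /negbTE ->.
Qed.

(** [m i] is the minimum of coordinate [i] on the grid points of [J]. If the sum were at most [N],
    some grid point would exceed [m i] wherever slack [i] is absent. Where it is present, its key 0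
    prevents domination, so no order would dominate that point. *)
Lemma dominating_minima (J : {set X}) : dominating key J ->
  exists m : 'I_n -> nat,
    (forall i x, inl i \notin J -> inr x \in J -> (m i <= gval x i)%N) /\
    (N < \sum_(i | inl i \notin J) (m i).+1)%N.
Proof.
move=> /dominatingP dom.
have noslack i y : (forall x, x \in J -> (key i (inr y) <= key i x)%N) -> inl i \notin J.
  by move=> H; apply/negP => /H; rewrite /= eqxx.
have Hm i : exists m, (forall x, inr x \in J -> (m <= gval x i)%N) /\
     (forall y, (forall x, inr x \in J -> (gval y i <= gval x i)%N) -> (gval y i <= m)%N).
  have [/existsP[x0 x0J]|/existsPn H] := boolP [exists x : grid, inr x \in J].
    case: (@arg_minnP _ x0 (fun x : grid => inr x \in J) (gval ^~ i) x0J) => x xJ xmin.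
    by exists (gval x i); split => // y; apply.
  (* Without grid points in [J], the default is the largest possible coordinate. *)
  exists N; split => [x xJ|y _]; first by have := H x; rewrite xJ.
  by rewrite -ltnS; apply: ltn_ord.
have [m Hm'] := fin_all_exists (P := fun i m => (forall x, inr x \in J -> (m <= gval x i)%N) /\
     (forall y, (forall x, inr x \in J -> (gval y i <= gval x i)%N) -> (gval y i <= m)%N)) Hm.
exists m; split; first by move=> i x _ xJ; have [H _] := Hm' i; apply: H.
have no_above y : (forall i, inl i \notin J -> (m i < gval y i)%N) -> False.
  move=> Hy; have [i Hi] := dom (inr y).
  have := Hy i (noslack _ _ Hi); have [_ H] := Hm' i; rewrite ltnNge => /negP; apply.
  by apply: H => x xJ; apply: key_gval; apply: Hi.
rewrite ltnNge; apply/negP => le.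
have [/existsP[i0 i0J]|/existsPn H] := boolP [exists i, inl i \notin J]; last first.
  by have [y _] := grid_inhabited; apply: (no_above y) => i iJ; have := H i; rewrite iJ.
(* The surplus is put on coordinate [i0] to reach the total [N]. *)
pose f i := ((if inl i \notin J then (m i).+1 else 0) +
  (if i == i0 then N - \sum_(i | inl i \notin J) (m i).+1 else 0))%N.
have [|y Hy] := @grid_of f.
  rewrite big_split /= -big_mkcond /= -[X in (_ + X)%N]big_mkcond /= big_pred1_eq.
  by rewrite subnKC.
by apply: (no_above y) => i iJ; rewrite Hy /f iJ leq_addr.
Qed.

Definition cut (x : grid) (j : nat) : nat := (\sum_(t < n | t < j) gval x t)%N.

Lemma cut0 x : cut x 0 = 0%N. Proof. by rewrite /cut big_pred0. Qed.

Lemma cutn x : cut x n = N.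
Proof. by rewrite -(sum_gval x); apply: eq_bigl => t; rewrite ltn_ord. Qed.

Lemma cutS x (i : 'I_n) : cut x i.+1 = (cut x i + gval x i)%N.
Proof.
rewrite /cut (bigD1 i) //= addnC; congr (_ + _)%N; apply: eq_bigl => t.
by rewrite ltnS ltn_neqAle andbC.
Qed.

Lemma cut_mono x i j : (i <= j)%N -> (cut x i <= cut x j)%N.
Proof.
move=> ij; rewrite /cut [X in (_ <= X)%N](bigID (fun t : 'I_n => (t < i)%N)) /=.
apply: leq_trans (leq_addr _ _); apply: eq_leq; apply: eq_bigl => t.
by case: (ltnP t i) => //= ti; rewrite ?andbF // (leq_trans ti ij).
Qed.

(** The coordinate minima over [J] add up to more than [N - n]. They bound the prefix of [y] from
    below, and the prefix of [x] from above through its suffix. *)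
Lemma cut_close (J : {set X}) x y j : dominating key J -> (forall i, inl i \notin J) ->
  inr x \in J -> inr y \in J -> (cut x j < cut y j + n)%N.
Proof.
move=> /dominating_minima [m [mJ mN]] slJ xJ yJ.
have -> : (cut x j = N - \sum_(t < n | ~~ (t < j)) gval x t)%N.
  by rewrite -(sum_gval x) (bigID (fun t : 'I_n => (t < j)%N)) /= addnK.
have l1 : (\sum_(t < n | ~~ (t < j)) m t <= \sum_(t < n | ~~ (t < j)) gval x t)%N.
  by apply: leq_sum => t _; apply: mJ.
have l2 : (\sum_(t < n | t < j) m t <= cut y j)%N.
  by apply: leq_sum => t _; apply: mJ.
have : (N < \sum_(t < n | t < j) m t + \sum_(t < n | ~~ (t < j)) m t + n)%N.
  move: mN; rewrite (eq_bigl predT) //= => h; apply: leq_trans h _.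
  rewrite (eq_bigr (fun t : 'I_n => m t + 1)%N); last by move=> t _; rewrite addn1.
  rewrite big_split /= sum1_card card_ord leq_add2r.
  by rewrite (bigID (fun t : 'I_n => (t < j)%N)).
move: l1 l2; move: (\sum_(t < n | t < j) m t)%N (\sum_(t < n | ~~ (t < j)) m t)%N.
move: (\sum_(t < n | ~~ (t < j)) gval x t)%N (cut y j) => a b c e; clear; lia.
Qed.

(** The coordinates whose slack is absent already use more than [N - n] of the total. *)
Lemma dominating_small (J : {set X}) x i : dominating key J -> inl i \in J ->
  inr x \in J -> (gval x i < n)%N.
Proof.
move=> /dominating_minima [m [mJ mN]] iJ xJ.
have h1 : (\sum_(t | inl t \notin J) m t <= \sum_(t | inl t \notin J) gval x t)%N.
  by apply: leq_sum => t tJ; apply: mJ.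
have h2 : (\sum_(t | inl t \notin J) gval x t + gval x i <= N)%N.
  apply: leq_trans (eq_leq (sum_gval x)).
  rewrite [X in (_ <= X)%N](bigID (fun t => inl t \notin J)) /= leq_add2l.
  by rewrite (bigD1 i) /= ?negbK // leq_addr.
have h3 : (\sum_(t | inl t \notin J) (m t).+1 <= \sum_(t | inl t \notin J) m t + n)%N.
  rewrite (eq_bigr (fun t => m t + 1)%N); last by move=> t _; rewrite addn1.
  rewrite big_split /= leq_add2l sum1_card -[X in (_ <= X)%N]card_ord.
  exact: max_card.
by move: (leq_trans mN h3) h1 h2; clear; lia.
Qed.

(* Slack [j] lies beyond the facet opposite to vertex [j]; labelling it with the
   cyclically next vertex keeps it inside that facet, so that no slack can occur
   in the final basis. *)
Theorem balanced_grid (R : realFieldType) (L : grid -> {set 'I_n}) :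
  (forall x, L x != set0) -> (forall x i, i \in L x -> (n <= gval x i)%N) ->
  exists (J : {set grid}) (w : grid -> R),
    [/\ forall x, 0 <= w x, forall x, x \notin J -> w x = 0,
        forall i, \sum_(x | i \in L x) w x = 1 &
        forall x y j, x \in J -> y \in J -> (cut x j < cut y j + n)%N].
Proof.
move=> L0 Lbig.
pose A (p : X) (i : 'I_n) : R :=
  match p with inl j => (i == ordS j)%:R | inr x => (i \in L x)%:R end.
have codomE (p : X) : p \notin codom (@inl 'I_n grid) -> exists x, p = inr x.
  by case: p => [j|x _]; [rewrite codom_f | exists x].
have [g _] := grid_inhabited.
have [||||||||||J [dom [w [w0 wJ wA]]]] := @scarf R X n key inl (@ordS n) A (inr g).
- by [].
- exact: key_inj.
- by move=> i j [].
- by move=> i x; rewrite /= eqxx.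
- move=> i j x ji /codomE[y ->]; apply: leq_trans (key_inr_lt i y) _.
  by rewrite [X in (_ <= X)%N]/= (negbTE ji) leq_addr.
- by apply/codomP => -[].
- exact: can_inj (@ordSK n).
- by move=> [j|x] i; rewrite ler0n.
- case=> [j|x]; first by exists (ordS j); rewrite /= eqxx ltr01.
  by have /set0Pn[i iL] := L0 x; exists i; rewrite /= iL ltr01.
- by [].
have wE i : \sum_x w x * A x i =
   w (inl (ord_pred i)) + \sum_(x : grid | i \in L x) w (inr x).
  rewrite big_sumType /=; congr (_ + _).
    rewrite (bigD1 (ord_pred i)) //= ord_predK eqxx mulr1 big1 ?addr0 // => j ji.
    case: eqP => [E|]; last by rewrite mulr0.
    by rewrite E ordSK eqxx in ji.
  rewrite [RHS]big_mkcond; apply: eq_bigr => x _.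
  by case: (i \in L x); rewrite ?mulr1 ?mulr0.
(* Grid points of [J] have coordinate [i] below [n], so their labels avoid [i]; row [i] is then
   filled by the slack labelled [i], which is [ord_pred i]. *)
have closed i : inl i \in J -> inl (ord_pred i) \in J.
  move=> iJ; apply: contraT => pJ; have := wA i; rewrite /comb wE wJ // add0r.
  rewrite big1 => [/esym/eqP|x iL]; first by rewrite oner_eq0.
  apply: wJ; apply/negP => xJ.
  by have := dominating_small dom iJ xJ; rewrite ltnNge Lbig.
(* Stepping back cyclically puts every slack in [J], and then no order dominates a grid point. *)
have noslack i : inl i \notin J.
  apply/negP => iJ; have allJ j : inl j \in J.
    have it m : inl (iter m (@ord_pred n) i) \in J.
      by elim: m => //= m; apply: closed.
    have pv (t : 'I_n) : (0 < t)%N -> (ord_pred t : nat) = t.-1.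
      move=> t0; rewrite /= -subn1 addnC -addnBA // modnDl modn_small ?subn1 //.
      by rewrite prednK // ltnW.
    have it0 : inl ord0 \in J.
      have -> : ord0 = iter i (@ord_pred n) i; last exact: it.
      have H m : (m <= i)%N -> (iter m (@ord_pred n) i : nat) = (i - m)%N.
        elim: m => [|m IH] mi; first by rewrite subn0.
        by rewrite iterS pv IH ?(ltnW mi) // ?subn_gt0 // subnS.
      by apply: ord_inj; rewrite H // subnn.
    have itd m (t : 'I_n) : (t = k - m :> nat)%N -> inl t \in J.
      elim: m t => [|m IH] t tm.
        have -> : t = ord_pred ord0 by apply: ord_inj; rewrite tm subn0 /= modn_small.
        exact: closed.
      have [mk|km] := ltnP m k; last first.
        have -> : t = ord0; last by [].
        by apply: ord_inj => /=; rewrite tm; apply/eqP; rewrite subn_eq0 (leq_trans km).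
      have lt : (t.+1 < n)%N by rewrite tm ltnS subnS prednK ?subn_gt0 // leq_subr.
      have -> : t = ord_pred (Ordinal lt) by apply: ord_inj; rewrite pv.
      apply: closed; apply: IH => /=; rewrite tm subnS prednK // subn_gt0 //.
    by apply: (itd (k - j)%N); rewrite subKn // -ltnS.
  have /dominatingP/(_ (inr g))[l Hl] := dom.
  by have := Hl _ (allJ l); rewrite /= eqxx.
exists [set x | inr x \in J], (fun x => w (inr x)); split => //.
- by move=> x; rewrite inE => /wJ.
- by move=> i; have := wA i; rewrite /comb wE wJ ?add0r.
- by move=> x y j; rewrite !inE => xJ yJ; apply: cut_close dom _ xJ yJ.
Qed.
End Grid.

(** * Hypergraphs of [d]-intervals *)

Section LeftEndpoints.
Variables (R : realFieldType) (d : nat) (H : seq (seq (R * R))).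
Hypothesis hd : dhypergraph d H.

(** Left endpoints discretise the line: moving a point left to the nearest of them leaves no
    interval that contained it. *)
Definition lefts : seq R := sort <=%O (undup [seq p.1 | p <- flatten H]).
Local Notation s := lefts.
Local Notation P := (size lefts).

Lemma edge_dint (i : nat) : (i < size H)%N -> is_dinterval d (edge H i).
Proof. by move=> iH; apply: hd; apply: mem_nth. Qed.

Lemma mem_lefts i I : (i < size H)%N -> I \in edge H i -> I.1 \in s.
Proof.
move=> iH Ii; rewrite mem_sort mem_undup; apply: map_f.
by apply/flattenP; exists (edge H i) => //; apply: mem_nth.
Qed.

Lemma lefts_mono a b : (a <= b)%N -> (b < P)%N -> nth 0 s a <= nth 0 s b.
Proof.
move=> ab bP; apply: (sorted_leq_nth le_trans le_refl) => //.
- exact: sort_le_sorted.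
- by rewrite inE (leq_ltn_trans ab).
Qed.

Lemma lefts_le a b : (a < P)%N -> (b < P)%N -> nth 0 s a <= nth 0 s b -> (a <= b)%N.
Proof.
move=> aP bP; apply: contraTT; rewrite -ltnNge -ltNge => ba.
rewrite lt_neqAle lefts_mono ?(ltnW ba) // andbT nth_uniq ?(ltn_eqF ba) //.
by rewrite sort_uniq undup_uniq.
Qed.

Lemma lefts_cover : is_cover H s.
Proof.
move=> i iH; have [h0 _ hI _] := edge_dint iH.
case E : (edge H i) h0 hI => [//|I h] _ hI; exists I.1.
  by apply: (mem_lefts iH); rewrite E mem_head.
by rewrite /in_dint /= /in_interval lexx hI ?mem_head.
Qed.

Definition last_left (v : R) : nat := (\max_(a < P | (nth 0 s a <= v)%R) a)%N.

Lemma last_leftP v a : (a < P)%N -> nth 0 s a <= v ->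
  [/\ (a <= last_left v)%N, (last_left v < P)%N & nth 0 s (last_left v) <= v].
Proof.
move=> aP av.
have [|b bv E] := @eq_bigmax_cond 'I_P (fun a => nth 0 s a <= v) (fun a => a).
  by apply/card_gt0P; exists (Ordinal aP).
have -> : last_left v = b by rewrite /last_left -E.
split => //; rewrite -E.
by apply: (leq_bigmax_cond (Ordinal aP)).
Qed.

(** * Cells cut out by a grid point *)

Section Cells.
Variable k : nat.
Local Notation n := k.+1.
Local Notation G := (2 * n)%N.
Local Notation N := (G * P)%N.
Local Notation grid := (grid k N).

(* Position [q] sits at the middle [G * q + n] of the block
   [G * q, G * q + G); a cut in that block kills it. *)
Definition kill (x : grid) (j : nat) : R := nth 0 s (cut x j %/ G).

Definition uncut (x : grid) (i : nat) : Prop :=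
  forall j, (0 < j < n)%N -> ~~ in_dint (edge H i) (kill x j).

Definition in_cell (x : grid) (q : nat) (i : nat) : bool :=
  (cut x i <= G * q + n < cut x i.+1)%N.

Definition cell (x : grid) (q : nat) : 'I_n := odflt ord0 [pick i : 'I_n | in_cell x q i].

Lemma cellP x q : (q < P)%N -> in_cell x q (cell x q).
Proof.
move=> qP; rewrite /cell; case: pickP => // none; exfalso.
have lt : (G * q + n < N)%N by move: qP; clear; nia.
suff Hj j : (j <= n)%N -> (cut x j <= G * q + n)%N.
  by have := Hj n (leqnn _); rewrite cutn leqNgt lt.
elim: j => [_|j IH jn]; first by rewrite cut0.
rewrite leqNgt; apply/negP => h.
by have := none (Ordinal jn); rewrite /in_cell /= h IH // ltnW.
Qed.

Lemma in_cell_inj x q i j : in_cell x q i -> in_cell x q j -> i = j.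
Proof.
wlog ij : i j / (i <= j)%N.
  by move=> W hi hj; case: (leqP i j) => [/W|/ltnW/W/(_ hj hi)]; [apply|].
move=> /andP[_ hi] /andP[hj _]; apply/eqP; rewrite eqn_leq ij /= leqNgt; apply/negP => lt.
by have := leq_trans (leq_trans hi (cut_mono x lt)) hj; rewrite ltnn.
Qed.

Lemma cell_eq x q (i : 'I_n) : (q < P)%N -> in_cell x q i -> cell x q = i.
Proof. by move=> qP hi; apply: ord_inj; apply: in_cell_inj (cellP x qP) hi. Qed.

(** Only the inner cuts matter, since the outer ones are 0 and [N] and every block middle lies
    between them. *)
Lemma in_cell_transfer (x y : grid) p q i : (i < n)%N -> (p < P)%N -> (q < P)%N ->
  (forall j, (0 < j < n)%N -> (cut x j <= G * p + n)%N = (cut y j <= G * q + n)%N) ->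
  in_cell x p i -> in_cell y q i.
Proof.
move=> iN pP qP E.
have ltN r : (r < P)%N -> (G * r + n < N)%N by clear; nia.
have E' j : (j <= n)%N -> (cut x j <= G * p + n)%N = (cut y j <= G * q + n)%N.
  move=> jn; have [->|j0] := posnP j; first by rewrite !cut0.
  have [lt|ge] := ltnP j n; first by rewrite E // j0.
  have -> : j = n by apply/eqP; rewrite eqn_leq jn ge.
  by rewrite !cutn [LHS]leqNgt [RHS]leqNgt !ltN.
case/andP => h1 h2; apply/andP; split; first by rewrite -E' // ltnW.
by rewrite ltnNge -E' // -ltnNge.
Qed.

(** A cut separating two listed points of [I] would kill a point of [I]. *)
Lemma cell_component x i I q : (i < size H)%N -> uncut x i -> I \in edge H i ->
  (q < P)%N -> in_interval I (nth 0 s q) -> cell x q = cell x (index I.1 s).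
Proof.
move=> iH unc Ii qP /andP[q1 q2].
have IP : (index I.1 s < P)%N by rewrite index_mem (mem_lefts iH).
have nthI : nth 0 s (index I.1 s) = I.1 by apply: nth_index; apply: mem_lefts iH Ii.
have aq : (index I.1 s <= q)%N by apply: lefts_le => //; rewrite nthI.
apply: cell_eq => //; apply: in_cell_transfer (cellP x IP) => // j jn.
apply/idP/idP => [h|h]; first by move: h aq; clear; nia.
rewrite leqNgt; apply/negP => lt.
have b1 : (index I.1 s <= cut x j %/ G)%N by rewrite leq_divRL //; move: lt; clear; lia.
have b2 : (cut x j %/ G <= q)%N.
  by rewrite -ltnS ltn_divLR //; move: h; clear; lia.
have /negP := unc j jn; apply; apply/hasP; exists I => //.
rewrite /in_interval /kill -{1}nthI lefts_mono //=; last exact: leq_ltn_trans b2 qP.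
by apply: le_trans q2; apply: lefts_mono.
Qed.

Lemma uncut_far x i q j : uncut x i -> in_dint (edge H i) (nth 0 s q) -> (0 < j < n)%N ->
  (cut x j < G * q \/ G * q + G <= cut x j)%N.
Proof.
move=> unc hq jn; have [h|h1] := ltnP (cut x j) (G * q); first by left.
have [h2|h] := ltnP (cut x j) (G * q + G); last by right.
have E : (cut x j %/ G = q)%N.
  apply/eqP; rewrite eqn_leq leq_divRL // -ltnS ltn_divLR //.
  by move: h1 h2; clear; lia.
by have := unc j jn; rewrite /kill E hq.
Qed.

(** The cuts of [x] avoid the whole block of [q], so a shift by less than [n], half a block, carries
    none across its middle. *)
Lemma cell_close x y i q : uncut x i -> (q < P)%N -> in_dint (edge H i) (nth 0 s q) ->
  (forall j, (cut x j < cut y j + n)%N) -> (forall j, (cut y j < cut x j + n)%N) ->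
  cell x q = cell y q.
Proof.
move=> unc qP hq xy yx; apply: cell_eq => //.
apply: in_cell_transfer (cellP y qP) => // j jn.
have := uncut_far unc hq jn; have := xy j; have := yx j.
move: (cut x j) (cut y j) => a b; clear; lia.
Qed.

Definition cells (h : grid -> 'I_(size H)) (x : grid) : {set 'I_n} :=
  [set i in [seq cell x (index p.1 s) | p <- edge H (h x)]].

(** The cell contains the middle of a block met by the edge. Its right end avoids that block, so the
    cell contains the right half, of length [n]. *)
Lemma cells_large (h : grid -> 'I_(size H)) x i : uncut x (h x) -> i \in cells h x -> (n <= gval x i)%N.
Proof.
move=> unc; rewrite inE => /mapP[I Ih ->] {i}.
have IP : (index I.1 s < P)%N by rewrite index_mem (mem_lefts (ltn_ord (h x)) Ih).
set i := cell _ _; have /andP[c1 c2] : in_cell x (index I.1 s) i by apply: cellP.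
have hI : in_dint (edge H (h x)) (nth 0 s (index I.1 s)).
  rewrite nth_index ?(mem_lefts (ltn_ord (h x)) Ih) //.
  apply/hasP; exists I => //; rewrite /in_interval lexx.
  by have [_ _ hI _] := edge_dint (ltn_ord (h x)); apply: hI.
have : (G * index I.1 s + G <= cut x i.+1)%N.
  have [lt|ge] := ltnP i.+1 n.
    have [|//] := uncut_far unc hI (j := i.+1) lt.
    by move: c2; clear; lia.
  have -> : i.+1 = n by apply/eqP; rewrite eqn_leq ge ltn_ord.
  by rewrite cutn; move: IP; clear; nia.
by rewrite cutS; move: c1; clear; lia.
Qed.
End Cells.

(** The last clause transfers results from the labels [L x] back to the edges: edges through a
    common point have labels with a common cell. *)
Lemma balanced_edges k : (forall C, is_cover H C -> (k < size C)%N) ->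
  exists (T : finType) (h : T -> 'I_(size H)) (L : T -> {set 'I_k.+1}) (w : T -> R),
    [/\ forall x, 0 <= w x, forall x, (0 < #|L x| <= d)%N,
        forall i, \sum_(x | i \in L x) w x = 1 &
        forall v, exists i, forall x, w x != 0 -> in_dint (edge H (h x)) v -> i \in L x].
Proof.
move=> Hk; pose N := (2 * k.+1 * P)%N.
have [h unc] : exists h : grid k N -> 'I_(size H), forall x, uncut x (h x).
  apply: (fin_all_exists (P := fun x (i : 'I_(size H)) => uncut x i)) => x.
  apply: NNPP => none.
  (* The [k] inner cuts give at most [k] points, too few for a cover. A cut at [N] yields the
     default value 0, which is still just one point. *)
  suff /Hk : is_cover H [seq kill x j | j <- iota 1 k] by rewrite size_map size_iota ltnn.
  move=> i iH; apply: NNPP => noc; apply: none; exists (Ordinal iH) => j jn.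
  apply/negP => hj; apply: noc; exists (kill x j) => //.
  by apply: map_f; rewrite mem_iota add1n.
have Lne x : (0 < #|cells h x| <= d)%N.
  have [h0 hdd _ _] := edge_dint (ltn_ord (h x)).
  apply/andP; split; last first.
    by apply: leq_trans hdd; rewrite cardsE -(size_map (fun p => cell x (index p.1 s))); apply: card_size.
  case E : (edge H (h x)) h0 => [//|I t] _; apply/card_gt0P.
  by exists (cell x (index I.1 s)); rewrite inE E mem_head.
have [||J [w [w0 wJ wL close]]] := @balanced_grid k N R (cells h).
- by move=> x; rewrite -card_gt0; have /andP[] := Lne x.
- by move=> x i; apply: cells_large.
exists (grid k N), h, (cells h), w; split => // v.
have [J0|[z zJ]] := set_0Vmem J.
  by exists ord0 => x; rewrite wJ ?eqxx // J0 inE.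
(* Any [z] in [J] serves as reference, because mutual closeness makes the cells agree. *)
exists (cell z (last_left v)) => x wx /hasP[I Ih /andP[Iv vI]].
have xJ : x \in J by apply: contra_neqT wx => /wJ.
have Is := mem_lefts (ltn_ord (h x)) Ih.
have [||le lP lv] := @last_leftP v (index I.1 s); rewrite ?index_mem ?nth_index //.
have qI : in_interval I (nth 0 s (last_left v)).
  rewrite /in_interval (le_trans lv vI) andbT -(nth_index 0 Is).
  exact: lefts_mono.
rewrite -(cell_close (unc x) lP) => [|||j]; last 2 first.
- by move=> j; apply: close.
- exact: close.
- by rewrite (cell_component (ltn_ord (h x)) (unc x) Ih) // inE; apply: map_f.
by apply/hasP; exists I.
Qed.
End LeftEndpoints.

(** * Minimum covers and the two inequalities *)

Lemma exists_min_cover (R : realFieldType) (H : seq (seq (R * R))) C0 : is_cover H C0 ->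
  exists C, is_cover H C /\ forall C', is_cover H C' -> (size C <= size C')%N.
Proof.
move=> H0; pose P m := pbool (exists C, is_cover H C /\ size C = m).
have ex : exists m, P m by exists (size C0); apply/pboolP; exists C0.
case: (ex_minnP ex) => m /pboolP[C [HC Cm]] mmin; exists C; split => // C' HC'.
by rewrite Cm; apply: mmin; apply/pboolP; exists C'.
Qed.

Unset Implicit Arguments.

Theorem theorem6p2 (R : realFieldType) (d : nat) (H : seq (seq (R * R))) :
  (1 <= d)%N -> dhypergraph d H ->
  (exists C : seq R, is_cover H C /\ (size C <= (d ^ 2 - d + 1) * nu H)%N) /\
  (exists C : seq R, exists f : 'I_(size H) -> R,
      [/\ is_cover H C, is_frac_matching H f &
          (size C)%:R <= d%:R * \sum_(i < size H) f i]).
Proof.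
move=> d1 hd; have [C [HC Cmin]] := exists_min_cover (lefts_cover hd).
case cC : (size C) => [|k].
  split; first by exists C; rewrite cC.
  exists C, (fun=> 0); rewrite cC; split => //; last by rewrite mulr_ge0 // sumr_ge0.
  by split => // v; rewrite big1 ?ler01.
have [|T [h [L [w [w0 wL w1 wv]]]]] := balanced_edges hd (k := k).
  by move=> C' /Cmin; rewrite cC.
have kW : k.+1%:R <= d%:R * \sum_x w x.
  have := sum_deg L w setT; rewrite (eq_bigr (fun=> 1)) => [|i _]; last exact: w1.
  rewrite sumr_const cardsT card_ord => ->; rewrite mulr_sumr; apply: ler_sum => x _.
  by rewrite mulrC ler_wpM2r // ler_nat setTI; have /andP[] := wL x.
split; exists C.
  split => //; rewrite cC.
  have [||M [Ms Md Mle]] := @furedi R 'I_k.+1 T L d w.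
  - by split => // i; rewrite /deg w1.
  - by move=> x _; apply: wL.
  have Mv x y v : x \in M -> y \in M -> x != y -> in_dint (edge H (h x)) v ->
      in_dint (edge H (h y)) v -> False.
    move=> xM yM xy vx vy; have [i Hi] := wv v.
    have /pred0P/(_ i) /= := Md _ _ xM yM xy.
    rewrite !Hi //; first by move: (subsetP Ms _ yM); rewrite inE.
    by move: (subsetP Ms _ xM); rewrite inE.
  (* Edges are nonempty, so two elements of [M] with the same edge would share a point. *)
  have hinj : {in M &, injective h}.
    move=> x y xM yM hxy; apply/eqP; apply: contraT => xy.
    have [v _ hv] := lefts_cover hd (ltn_ord (h x)).
    by case: (Mv x y v xM yM xy hv); rewrite -hxy.
  have cM : (#|M| <= nu H)%N.
    rewrite -(card_in_imset hinj).
    apply: (@leq_bigmax_cond _ (fun M => pbool (is_matching H M)) (fun M => #|M|)).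
    apply/pboolP => _ _ /imsetP[x xM ->] /imsetP[y yM ->] hxy v /andP[vx vy].
    by apply: Mv xM yM _ vx vy; apply: contraNneq hxy => ->.
  apply: leq_trans (_ : ((d ^ 2 - d + 1) * #|M| <= _)%N); last by rewrite leq_mul2l cM orbT.
  by rewrite -(ler_nat R) natrM; apply: le_trans kW Mle.
(* Several grid points may select the same edge, so weights are added over the fibres of [h]. *)
exists (fun i => \sum_(x | h x == i) w x); split => //; last first.
  by rewrite cC; move: kW; rewrite (partition_big h predT).
split => [i|v]; first exact: sumr_ge0.
have -> : \sum_(i < size H | in_dint (edge H i) v) \sum_(x | h x == i) w x
        = \sum_(x | in_dint (edge H (h x)) v) w x.
  rewrite [RHS](partition_big h (fun i : 'I_(size H) => in_dint (edge H i) v)) //.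
  apply: eq_bigr => i iv; apply: eq_bigl => x.
  by case: eqP => [->|]; rewrite ?iv ?andbF.
have [i Hi] := wv v; rewrite -(w1 i) big_mkcond [leRHS]big_mkcond /=.
apply: ler_sum => x _; case: ifP => // vx; last by case: ifP.
by have [->|wx] := eqVneq (w x) 0; [case: ifP | rewrite Hi].
Qed.
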